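(* Let $\mathbf{V}$ be a pseudovariety of groups that is closed under extensions with abelian kernel, let $X$ be a finite set, let $F$ be the free group on $X$, and let $H$ be a finitely generated subgroup of $F$. If $H$ is closed in the pro-$\mathbf{V}$ topology of $F$, then the Stallings graph $\mathcal{S}(H)$ is a labelled subgraph of some finite connected $X$-labelled graph $\mathcal{S}(H)^+$ that is a covering and whose group of deck transformations (in the sense defined in the context) lies in $\mathbf{V}$.
   Context: A pseudovariety of groups is a class $\mathbf{V}$ of finite groups (closed under isomorphism) closed under subgroups, quotients, and finite direct products. It is closed under extensions with abelian kernel if, for every normal abelian subgroup $N\trianglelefteq G$ of a group $G$, $N,G/N\in\mathbf{V}$ imply $G\in\mathbf{V}$. The pro-$\mathbf{V}$ topology of a group $G$ is the group topology for which the normal subgroups $N\trianglelefteq G$ with $G/N\in\mathbf{V}$ form a neighborhood base at the identity. Graphs are finite and in the sense of Serre: each edge $e$ has an initial vertex $\alpha(e)$, a terminal vertex $\omega(e)$, and a reverse edge $\bar e\neq e$ with $\bar{\bar e}=e$, $\alpha(\bar e)=\omega(e)$, $\omega(\bar e)=\alpha(e)$. An $X$-labelled graph has a label $\ell(e)\in X\sqcup X^{-1}$ on each edge $e$, with $\ell(\bar e)=\ell(e)^{-1}$. It is an immersion (resp. covering) if for each vertex $v$ and each $a\in X\sqcup X^{-1}$ there is at most one (resp. exactly one) edge with initial vertex $v$ and label $a$. Stallings graph: a pair $(e_1,e_2)$ of distinct edges is admissible if $e_2\neq\bar e_1$, $\alpha(e_1)=\alpha(e_2)$ and $\ell(e_1)=\ell(e_2)$;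 folding it means identifying $e_1\sim e_2$, $\bar e_1\sim\bar e_2$ and $\omega(e_1)\sim\omega(e_2)$. Given a finitely generated subgroup $H=\langle w_1,\dots,w_m\rangle\leq F$ with each $w_i$ a reduced word, take the wedge at a basepoint $v$ of $m$ cycles $C_1,\dots,C_m$, where $C_i$ has length $|w_i|$ and is labelled by the word $w_i$ when read starting from $v$; then repeatedly fold until no admissible pairs remain. The resulting finite connected based graph $(\mathcal{S}(H),v)$ is the Stallings graph of $H$; it is an immersion. Group of deck transformations: if $\Delta$ is a finite covering with vertex set $V$, then $F$ acts on $V$ on the right, where $u\cdot w$ is the terminal vertex of the unique path in $\Delta$ starting at $u$ with label $w$. The ''group of deck transformations'' of $\Delta$ is the group of permutations of $V$ induced by this action, i.e. the quotient of $F$ by the kernel of the action. For $\Delta$ connected with basepoint $v$, and $U=\pi_1(\Delta,v)\leq F$ the subgroup of labels of loops at $v$, it is isomorphic to $F/U_F$, where $U_F=\bigcap_{g\in F}gUg^{-1}$. *)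

(* Defs.v *)
From HB Require Import structures.
From mathcomp Require Import all_boot all_fingroup.
From mathcomp Require Import boolp classical_sets filter.
From mathcomp Require Import topology_structure.

Set Implicit Arguments.
Unset Strict Implicit.
Unset Printing Implicit Defensive.

Local Open Scope group_scope.
Local Open Scope classical_set_scope.

(* Finite products include the empty one, so the trivial groups belong to every
   pseudovariety. *)
Record pseudovariety := Pseudovariety {
  in_pv :> forall gT : finGroupType, {group gT} -> Prop;
  pv_isog : forall (gT hT : finGroupType) (G : {group gT}) (H : {group hT}),
    G \isog H -> in_pv G -> in_pv H;
  pv_sub : forall (gT : finGroupType) (G H : {group gT}),
    H \subset G -> in_pv G -> in_pv H;
  pv_quo : forall (gT : finGroupType) (G N : {group gT}),
    N <| G -> in_pv G -> in_pv (G / N)%G;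
  pv_prod : forall (I : finType) (gT : I -> finGroupType)
      (G : forall i, {group gT i}),
    (forall i, in_pv (G i)) -> in_pv (setXn_group G)
}.

Definition closed_under_abelian_kernel_extensions (V : pseudovariety) : Prop :=
  forall (gT : finGroupType) (G N : {group gT}),
    N <| G -> abelian N -> V gT N -> V _ (G / N)%G -> V gT G.

Section Subgroups.
Variable G : groupType.

Definition is_subgroup (A : set G) : Prop :=
  A 1 /\ forall x y, A x -> A y -> A (x * y^-1).

Definition is_normal_subgroup (N : set G) : Prop :=
  is_subgroup N /\ forall x y, N x -> N (x ^ y).

Definition generated m (w : 'I_m -> G) : set G :=
  smallest is_subgroup (range w).

Definition finitely_generated (A : set G) : Prop :=
  exists m (w : 'I_m -> G), A = generated w.

(* [G / N] is isomorphic to a member [Q] of [V]: some homomorphism maps [G]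
   onto [Q] with kernel [N]. *)
Definition quotient_in (V : pseudovariety) (N : set G) : Prop :=
  exists (gT : finGroupType) (Q : {group gT}) (f : G -> gT),
    [/\ {morph f : x y / x * y}, range f = [set y | y \in Q],
        N = [set x | f x = 1] & V gT Q].

End Subgroups.

Definition pro_topology (V : pseudovariety) (G : groupType) : Type := G.

Section ProTopology.
Variables (V : pseudovariety) (G : groupType).
Local Notation T := (pro_topology V G).

HB.instance Definition _ := Choice.copy T G.

Definition pro_nbhs (x : T) : set_system T :=
  [set A | exists N : set G, [/\ is_normal_subgroup N, quotient_in V N &
    forall n, N n -> A ((x : G) * n)]].

HB.instance Definition _ := hasNbhs.Build T pro_nbhs.

Lemma morph_one (gT : groupType) (f : G -> gT) :
  {morph f : x y / x * y} -> f 1 = 1.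
Proof. by move=> fM; apply: (mulgI (f 1)); rewrite -fM !mulg1. Qed.

Lemma image_group_set (gT : finGroupType) (f : G -> gT) :
  {morph f : x y / x * y} ->
  group_set (finset (fun y : gT => `[< exists x, f x = y >])).
Proof.
move=> fM; apply/group_setP; split=> [|a b].
  by rewrite !inE; exists 1; exact: morph_one.
rewrite !inE => -[x fx] [y fy].
by exists (x * y); rewrite fM fx fy.
Qed.

Lemma quotient_in_forall (I : finType) (N : I -> set G) :
  (forall i, quotient_in V (N i)) -> quotient_in V [set x | forall i, N i x].
Proof.
move=> hN.
have hN' i : exists q : {gT : finGroupType & ({group gT} * (G -> gT))%type},
    [/\ {morph (projT2 q).2 : x y / x * y},
        range (projT2 q).2 = [set y | y \in (projT2 q).1],
        N i = [set x | (projT2 q).2 x = 1] & V _ (projT2 q).1].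
  by have [gT [Q [f h]]] := hN i; exists (existT _ gT (Q, f)).
have {hN'} [q qP] := choice hN'.
pose gT i := projT1 (q i).
pose Q i : {group gT i} := (projT2 (q i)).1.
pose f i : G -> gT i := (projT2 (q i)).2.
pose F x : {dffun forall i, gT i} := [ffun i => f i x].
have FM : {morph F : x y / x * y}.
  by move=> x y; apply/ffunP => i; rewrite !ffunE /f; have [-> _ _ _] := qP i.
exists _, (Group (image_group_set FM)), F; split=> //.
- apply/seteqP; split=> [_ [x _ <-]|y] /=.
    by rewrite !inE; exists x.
  by rewrite !inE => -[x <-]; exists x.
- apply/seteqP; split=> x /= h.
    apply/ffunP => i; rewrite !ffunE.
    by have := h i; have [_ _ -> _] := qP i.
  move=> i; have [_ _ -> _] := qP i.
  by move/ffunP/(_ i): h; rewrite !ffunE.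
- apply: (@pv_sub V _ (setXn_group Q)); last first.
    by apply: pv_prod => i; case: (qP i).
  apply/fintype.subsetP => y; rewrite !inE => -[x <-]; apply/forallP => i.
  rewrite ffunE; have [_ fQ _ _] := qP i.
  by have : range (f i) (f i x) by []; rewrite fQ.
Qed.

Lemma normal_forall (I : Type) (N : I -> set G) :
  (forall i, is_normal_subgroup (N i)) ->
  is_normal_subgroup [set x | forall i, N i x].
Proof.
move=> hN; split; first split=> [i|x y hx hy i].
- by have [[]] := hN i.
- by have [[_ h] _] := hN i; apply: h.
- by move=> x y hx i; have [_ h] := hN i; apply: h.
Qed.

Lemma pro_nbhs_filter (x : T) : ProperFilter (nbhs x).
Proof.
split.
  by move=> [N [[[N1 _] _] _ /(_ _ N1)]].
split.
- exists [set y | forall i : void, set0 y]; split=> //.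
    exact: (@normal_forall void (fun=> set0)).
  exact: (@quotient_in_forall void (fun=> set0)).
- move=> A B [N [nN qN NA]] [M [nM qM MB]].
  pose K (b : bool) := if b then N else M.
  exists [set y | forall b, K b y]; split=> [||n nK].
  + by apply: normal_forall; case.
  + by apply: quotient_in_forall; case.
  + by split; [apply: NA (nK true)|apply: MB (nK false)].
- by move=> A B AB [N [nN qN NA]]; exists N; split=> // n /NA /AB.
Qed.

Lemma pro_nbhs_singleton (x : T) (A : set T) : nbhs x A -> A x.
Proof. by move=> [N [[[N1 _] _] _ /(_ _ N1)]]; rewrite mulg1. Qed.

Lemma pro_nbhs_nbhs (x : T) (A : set T) : nbhs x A -> nbhs x (nbhs^~ A).
Proof.
move=> [N [nN qN NA]]; exists N; split=> // n Nn; exists N; split=> // m Nm.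
rewrite -mulgA; apply: NA; have [[N1 NB] _] := nN.
rewrite -[m]invgK; apply: (NB) => //.
by rewrite -[m^-1]mul1g; apply: NB.
Qed.

HB.instance Definition _ := Nbhs_isNbhsTopological.Build T
  pro_nbhs_filter pro_nbhs_singleton pro_nbhs_nbhs.

End ProTopology.

Definition pro_closed (V : pseudovariety) (G : groupType) (A : set G) : Prop :=
  closed (A : set (pro_topology V G)).

(* [(x, false)] is the letter [x], and [(x, true)] is its formal inverse. *)
Definition letter (X : Type) : Type := (X * bool)%type.

Definition inv_letter (X : Type) (a : letter X) : letter X := (a.1, ~~ a.2).

Section FreeGroup.
Variable X : finType.
Implicit Types (a b : letter X) (u v w : seq (letter X)).

Definition reduced w : bool := sorted (fun a b => b != inv_letter a) w.

Record free_group := FreeGroup {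
  fg_word :> seq (letter X);
  fg_reduced : reduced fg_word
}.

HB.instance Definition _ := [isSub for fg_word].
HB.instance Definition _ := [Choice of free_group by <:].

Definition push a w : seq (letter X) :=
  if w is b :: w' then if b == inv_letter a then w' else a :: w else [:: a].

Definition inv_word w : seq (letter X) := rev (map (@inv_letter X) w).

Lemma inv_letterK : involutive (@inv_letter X).
Proof. by case=> x b; rewrite /inv_letter /= negbK. Qed.

Lemma reduced_behead a w : reduced (a :: w) -> reduced w.
Proof. exact: path_sorted. Qed.

Lemma push_reduced a w : reduced w -> reduced (push a w).
Proof.
case: w => [//|b w]; rewrite /push; case: eqP => [_ /reduced_behead //|/eqP nb].
by rewrite /reduced /= nb.
Qed.

Lemma pushK a w : reduced w -> push a (push (inv_letter a) w) = w.
Proof.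
case: w => [|b w] /=; first by rewrite eqxx.
rewrite inv_letterK; case: eqP => [-> |_ _] /=; last by rewrite eqxx.
by case: w => [|c w] //= /andP[/negPf ->].
Qed.

Lemma foldr_push_reduced u w : reduced w -> reduced (foldr push w u).
Proof. by move=> rw; elim: u => //= a u; apply: push_reduced. Qed.

Lemma foldr_push_nil u : reduced u -> foldr push [::] u = u.
Proof.
elim: u => //= a u IHu /[dup] /reduced_behead /IHu ->.
by case: u {IHu} => //= b u /andP[/negPf ->].
Qed.

Lemma foldr_push_push a u w :
  reduced u -> reduced w -> foldr push w (push a u) = push a (foldr push w u).
Proof.
case: u => [//|b u] ru rw /=; case: eqP => [->|//] /=.
by rewrite pushK // foldr_push_reduced.
Qed.

Lemma foldr_push_cat u v w : reduced v -> reduced w ->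
  foldr push w (foldr push v u) = foldr push (foldr push w v) u.
Proof.
move=> rv rw; elim: u => //= a u IHu.
by rewrite foldr_push_push ?IHu // foldr_push_reduced.
Qed.

Lemma inv_word_reduced w : reduced w -> reduced (inv_word w).
Proof.
rewrite /reduced /inv_word rev_sorted sorted_map; apply: sub_sorted => a b.
by rewrite /= !inv_letterK eq_sym.
Qed.

Lemma inv_wordK : involutive inv_word.
Proof.
by move=> w; rewrite /inv_word map_rev revK -map_comp map_id_in // => a _;
   rewrite /= inv_letterK.
Qed.

Lemma foldr_push_inv u w : reduced w ->
  foldr push (foldr push w u) (inv_word u) = w.
Proof.
elim: u w => //= a u IHu w rw.
rewrite /inv_word /= rev_cons -cats1 foldr_cat /= -{2}[a]inv_letterK.
by rewrite pushK ?foldr_push_reduced // IHu.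
Qed.

Definition fg_one : free_group := @FreeGroup [::] isT.
Definition fg_mul (x y : free_group) : free_group :=
  FreeGroup (foldr_push_reduced x (fg_reduced y)).
Definition fg_inv (x : free_group) : free_group :=
  FreeGroup (inv_word_reduced (fg_reduced x)).

Lemma fg_mulA : associative fg_mul.
Proof.
by move=> x y z; apply: val_inj; rewrite /= foldr_push_cat // fg_reduced.
Qed.

Lemma fg_mul1 : left_id fg_one fg_mul.
Proof. by move=> x; apply: val_inj. Qed.

Lemma fg_mulr1 : right_id fg_one fg_mul.
Proof.
by move=> x; apply: val_inj; rewrite /= foldr_push_nil // fg_reduced.
Qed.

Lemma fg_mulV : left_inverse fg_one fg_inv fg_mul.
Proof.
move=> x; apply: val_inj => /=.
by rewrite -{1}(foldr_push_nil (fg_reduced x)) foldr_push_inv.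
Qed.

Lemma fg_mulrV : right_inverse fg_one fg_inv fg_mul.
Proof.
move=> x; rewrite -{1}[x](_ : fg_inv (fg_inv x) = x) ?fg_mulV //.
by apply: val_inj; rewrite /= inv_wordK.
Qed.

HB.instance Definition _ := isGroup.Build free_group
  fg_mulA fg_mul1 fg_mulr1 fg_mulV fg_mulrV.

End FreeGroup.

Record lgraph (X : finType) := LGraph {
  vertex : finType;
  edge : finType;
  src : edge -> vertex;
  tgt : edge -> vertex;
  bar : edge -> edge;
  lab : edge -> letter X;
  bar_neq : forall e, bar e != e;
  barK : involutive bar;
  src_bar : forall e, src (bar e) = tgt e;
  tgt_bar : forall e, tgt (bar e) = src e;
  lab_bar : forall e, lab (bar e) = inv_letter (lab e)
}.

Section Graphs.
Variable X : finType.
Implicit Types D S : lgraph X.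

Fixpoint walk D (u : vertex D) (p : seq (edge D)) (v : vertex D) : bool :=
  if p is e :: p' then (src e == u) && walk (tgt e) p' v else u == v.

Definition labelled_walk D (u : vertex D) (w : seq (letter X)) (v : vertex D) :=
  exists2 p, walk u p v & map (@lab X D) p = w.

Definition connected D : Prop :=
  forall u v : vertex D, exists p, walk u p v.

Definition covering D : Prop :=
  forall (v : vertex D) (a : letter X),
    exists! e : edge D, src e = v /\ lab e = a.

Definition labelled_subgraph S D : Prop :=
  exists (fv : vertex S -> vertex D) (fe : edge S -> edge D),
    [/\ injective fv, injective fe,
        forall e, src (fe e) = fv (src e) /\ tgt (fe e) = fv (tgt e),
        forall e, bar (fe e) = fe (bar e) &
        forall e, lab (fe e) = lab e].

Section Deck.
Variables (D : lgraph X) (covD : covering D).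

Lemma covering_inj (e e' : edge D) : src e = src e' -> lab e = lab e' -> e = e'.
Proof.
by move=> se le; have [f [_ fP]] := covD (src e) (lab e);
   rewrite -(fP e) // -(fP e').
Qed.

Lemma labelled_walk_push (u v : vertex D) a w :
  labelled_walk u (a :: w) v -> labelled_walk u (push a w) v.
Proof.
move=> [[//|e p] /= /andP[/eqP su pv] [la lw]].
case: w lw => [|b w] lw /=.
  by exists (e :: p); rewrite /= ?su ?eqxx ?la ?lw.
case: eqP => [eb|_]; last by exists (e :: p); rewrite /= ?su ?eqxx ?la ?lw.
case: p lw pv => //= f p [lf lw] /andP[/eqP sf pv]; exists p => //.
suff ef : f = bar e by rewrite -su -[src e]tgt_bar -ef.
by apply: covering_inj; rewrite ?sf ?src_bar // lf eb lab_bar la.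
Qed.

Lemma labelled_walk_mul (x y : free_group X) (u v t : vertex D) :
  labelled_walk u x v -> labelled_walk v y t ->
  labelled_walk u (x * y : free_group X) t.
Proof.
rewrite [fg_word (x * y)]/=.
elim: (fg_word x) u => [|a w IHw] u [p pv lp] yt /=.
  by case: p pv lp => //= /eqP ->.
case: p pv lp => //= e p /andP[/eqP su pv] [la lw]; apply: labelled_walk_push.
have [q qt lq] := IHw (tgt e) (ex_intro2 _ _ p pv lw) yt.
by exists (e :: q); rewrite /= ?su ?eqxx ?la ?lq.
Qed.

(* Walks labelled by a given word and starting at a given vertex are unique, so
   this says that [p] is the permutation [u |-> u . w] of the right action. *)
Definition induced_by (w : free_group X) (p : {perm vertex D}) : Prop :=
  forall u, labelled_walk u w (p u).

Lemma deck_group_set :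
  group_set (finset (fun p : {perm vertex D} =>
    `[< exists w, induced_by w p >])).
Proof.
apply/group_setP; split=> [|p q].
  rewrite !inE; exists 1 => u; exists [::] => //=.
  by rewrite perm1.
rewrite !inE => -[x xp] [y yq].
by exists (x * y) => u; rewrite permM; apply: labelled_walk_mul (xp u) (yq _).
Qed.

Definition deck_group : {group {perm vertex D}} := Group deck_group_set.

End Deck.

Record based_graph := BasedGraph {
  bgraph :> lgraph X;
  base : vertex bgraph
}.

Section Wedge.
Variables (m : nat) (w : 'I_m -> free_group X).

(* [None] is the basepoint, and the other vertices of the [i]-th cycle are
   numbered by ['I_(size (w i)).-1]. *)
Definition wedge_vertex : finType := option {i : 'I_m & 'I_(size (w i)).-1}.

(* The [k]-th point of the [i]-th cycle; it is the basepoint for [k = 0] and for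
   [k = size (w i)]. *)
Definition wedge_point (i : 'I_m) (k : nat) : wedge_vertex :=
  if k is k'.+1 then
    omap (fun j => existT (fun i => 'I_(size (w i)).-1) i j) (insub k')
  else None.

(* [(existT i k, false)] is the [k]-th edge of the [i]-th cycle, oriented along
   the word [w i], and [(existT i k, true)] is its reverse. *)
Definition wedge_edge : finType := ({i : 'I_m & 'I_(size (w i))} * bool)%type.

Definition wedge_end (e : wedge_edge) (b : bool) : wedge_vertex :=
  wedge_point (tag e.1) (b + tagged e.1)%N.
Definition wedge_src (e : wedge_edge) := wedge_end e e.2.
Definition wedge_tgt (e : wedge_edge) := wedge_end e (~~ e.2).
Definition wedge_bar (e : wedge_edge) : wedge_edge := (e.1, ~~ e.2).
Definition wedge_lab (e : wedge_edge) : letter X :=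
  let a := tnth (in_tuple (w (tag e.1))) (tagged e.1) in
  if e.2 then inv_letter a else a.

Lemma wedge_bar_neq e : wedge_bar e != e.
Proof. by case: e => e []; rewrite /wedge_bar -pair_eqE /= andbF. Qed.

Lemma wedge_barK : involutive wedge_bar.
Proof. by case=> e b; rewrite /wedge_bar /= negbK. Qed.

Lemma wedge_tgt_bar e : wedge_tgt (wedge_bar e) = wedge_src e.
Proof. by case: e => e b; rewrite /wedge_tgt /= negbK. Qed.

Lemma wedge_lab_bar e : wedge_lab (wedge_bar e) = inv_letter (wedge_lab e).
Proof. by case: e => e []; rewrite /wedge_lab /= ?inv_letterK. Qed.

Definition wedge : based_graph := @BasedGraph
  (@LGraph X wedge_vertex wedge_edge wedge_src wedge_tgt wedge_bar wedge_lab
     wedge_bar_neq wedge_barK (fun=> erefl) wedge_tgt_bar wedge_lab_bar)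
  None.

End Wedge.

Section Fold.
Variables (D : based_graph) (e1 e2 : edge D).

Definition admissible : bool :=
  [&& e1 != e2, e2 != bar e1, src e1 == src e2 & lab e1 == lab e2].

(* Vertices and edges are identified by keeping one representative of each
   class: [tgt e1], [e1] and [bar e1] stand for the classes of [tgt e2], [e2]
   and [bar e2]. *)
Definition fold_vertex : finType :=
  {v : vertex D | (v == tgt e1) || (v != tgt e2)}.
Definition fold_edge : finType :=
  {e : edge D | (e != e2) && (e != bar e2)}.

Definition fold_repr (v : vertex D) := if v == tgt e2 then tgt e1 else v.

Lemma fold_reprP v : (fold_repr v == tgt e1) || (fold_repr v != tgt e2).
Proof. by rewrite /fold_repr; case: ifP => [_|->]; rewrite ?eqxx ?orbT. Qed.

Lemma fold_barP (e : fold_edge) :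
  (bar (val e) != e2) && (bar (val e) != bar e2).
Proof.
case: e => e /= /andP[ne nb]; rewrite (inj_eq (can_inj (@barK _ D))) ne andbT.
by apply: contra nb => /eqP <-; rewrite barK.
Qed.

Definition fold_point v : fold_vertex := Sub (fold_repr v) (fold_reprP v).
Definition fold_src (e : fold_edge) : fold_vertex := fold_point (src (val e)).
Definition fold_tgt (e : fold_edge) : fold_vertex := fold_point (tgt (val e)).
Definition fold_bar (e : fold_edge) : fold_edge :=
  Sub (bar (val e)) (fold_barP e).
Definition fold_lab (e : fold_edge) : letter X := lab (val e).

Lemma fold_bar_neq e : fold_bar e != e.
Proof. by rewrite -val_eqE /= bar_neq. Qed.

Lemma fold_barK : involutive fold_bar.
Proof. by move=> e; apply: val_inj; rewrite /= barK. Qed.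

Lemma fold_src_bar e : fold_src (fold_bar e) = fold_tgt e.
Proof. by rewrite /fold_src /= src_bar. Qed.

Lemma fold_tgt_bar e : fold_tgt (fold_bar e) = fold_src e.
Proof. by rewrite /fold_tgt /= tgt_bar. Qed.

Lemma fold_lab_bar e : fold_lab (fold_bar e) = inv_letter (fold_lab e).
Proof. by rewrite /fold_lab /= lab_bar. Qed.

Definition fold : based_graph := @BasedGraph
  (@LGraph X fold_vertex fold_edge fold_src fold_tgt fold_bar fold_lab
     fold_bar_neq fold_barK fold_src_bar fold_tgt_bar fold_lab_bar)
  (fold_point (base D)).

End Fold.

Inductive folds_to : based_graph -> based_graph -> Prop :=
| Folded (D : based_graph) :
    (forall e1 e2 : edge D, ~~ admissible e1 e2) -> folds_to D D
| Fold (D : based_graph) (e1 e2 : edge D) (S : based_graph) :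
    admissible e1 e2 -> folds_to (fold e1 e2) S -> folds_to D S.

Lemma folds_to_exists (D : based_graph) : exists S : based_graph, folds_to D S.
Proof.
have [n] := ubnP #|edge D|; elim: n D => // n IHn D ltDn.
have [[[e1 e2] /= adm]|nadm] :=
    pselect (exists e : edge D * edge D, admissible e.1 e.2); last first.
  exists D; apply: Folded => e1 e2; apply/negP => adm.
  by apply: nadm; exists (e1, e2).
have [|S foldS] := IHn (fold e1 e2); last by exists S; apply: Fold foldS.
apply: leq_trans (ltDn : #|edge D| <= n)%N; rewrite card_sig.
apply: proper_card.
apply/properP; split; first exact/fintype.subsetP.
by exists e2; rewrite // !inE eqxx.
Qed.

(* Up to isomorphism, [S] depends neither on the generators of [H] nor on the
   order of the foldings; every choice of them is allowed here. *)
Definition stallings_graph (H : set (free_group X)) (S : based_graph) : Prop :=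
  exists m (w : 'I_m -> free_group X), H = generated w /\ folds_to (wedge w) S.

End Graphs.

(* Main.v *)
(** A finitely generated subgroup [H] is recovered from its Stallings graph
    [S]: there is a map [g] from the vertices of [S] to the free group [F] such
    that an edge from [u] to [v] labelled [a] satisfies [H g(u) a = H g(v)], and
    the cosets [H g(v)] are pairwise distinct.  Hence [g(u) g(v)^-1] is outside
    [H] for the finitely many pairs [u <> v]; as [H] is closed, a single normal
    subgroup [N] with [F / N] in [V] keeps all these elements outside [H N].
    The Schreier graph of [H N] then contains [S], and its group of deck
    transformations is a quotient of [F / N].  Closure of [V] under extensions
    plays no role. *)

Require Import Defs.
From mathcomp Require Import all_boot all_fingroup.
From mathcomp Require Import classical_sets.
From mathcomp Require Import boolp topology_structure.

Set Implicit Arguments.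
Unset Strict Implicit.
Unset Printing Implicit Defensive.

Local Open Scope group_scope.

Section SameRightCoset.
Variables (G : groupType) (H : set G).
Hypothesis subgroupH : is_subgroup H.

Lemma is_subgroupV x : H x -> H x^-1.
Proof. by case: subgroupH => H1 HB Hx; rewrite -[x^-1]mul1g; apply: HB. Qed.

Definition same_rcoset x y := H (x * y^-1).

Lemma same_rcoset_refl x : same_rcoset x x.
Proof. by case: subgroupH => H1 _; rewrite /same_rcoset mulgV. Qed.

Lemma same_rcoset_sym x y : same_rcoset x y -> same_rcoset y x.
Proof. by move=> /is_subgroupV; rewrite /same_rcoset invMg invgK. Qed.

Lemma same_rcoset_trans y x z :
  same_rcoset x y -> same_rcoset y z -> same_rcoset x z.
Proof.
case: subgroupH => _ HB Hxy /same_rcoset_sym Hzy.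
by have := HB _ _ Hxy Hzy; rewrite /same_rcoset invMg invgK mulgA mulgVK.
Qed.

Lemma same_rcoset_mem x y : same_rcoset x y -> H y -> H x.
Proof.
case: subgroupH => _ HB Hxy /is_subgroupV Hy.
by have := HB _ _ Hxy Hy; rewrite invgK mulgVK.
Qed.

Lemma same_rcosetMr z x y : same_rcoset x y -> same_rcoset (x * z) (y * z).
Proof. by rewrite /same_rcoset invMg mulgA mulgK. Qed.

End SameRightCoset.

Section Words.
Variable X : finType.
Implicit Types (a : letter X) (w : seq (letter X)).

Definition word_elt w : free_group X :=
  FreeGroup (foldr_push_reduced w (isT : reduced [::])).

Definition letter_elt a : free_group X := @FreeGroup X [:: a] isT.

Lemma word_elt_nil : word_elt [::] = 1.
Proof. exact: val_inj. Qed.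

Lemma word_elt_cons a w : word_elt (a :: w) = letter_elt a * word_elt w.
Proof. exact: val_inj. Qed.

Lemma word_elt_cat w1 w2 : word_elt (w1 ++ w2) = word_elt w1 * word_elt w2.
Proof.
elim: w1 => [|a w1 IHw] /=; first by rewrite word_elt_nil mul1g.
by rewrite !word_elt_cons IHw mulgA.
Qed.

Lemma word_eltK (x : free_group X) : word_elt x = x.
Proof. by apply: val_inj; rewrite /= foldr_push_nil // fg_reduced. Qed.

Lemma letter_eltV a : letter_elt (inv_letter a) = (letter_elt a)^-1.
Proof. exact: val_inj. Qed.

End Words.

Section Walks.
Variables (X : finType) (D : lgraph X).
Implicit Types (u v t : vertex D) (e : edge D) (w : seq (letter X)).

Lemma labelled_walk_edge e : labelled_walk (src e) [:: lab e] (tgt e).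
Proof. by exists [:: e]; rewrite //= !eqxx. Qed.

Lemma labelled_walk_cat v u t w1 w2 :
  labelled_walk u w1 v -> labelled_walk v w2 t -> labelled_walk u (w1 ++ w2) t.
Proof.
move=> [p pv <-] [q qt <-]; exists (p ++ q); last exact: map_cat.
elim: p u pv => [|e p IHp] u /=; first by move=> /eqP ->.
by move=> /andP[-> /IHp].
Qed.

Lemma labelled_walk_inv u v w :
  labelled_walk u w v -> labelled_walk v (inv_word w) u.
Proof.
elim: w u => [|a w IHw] u [[|e p] //= uv lp].
  by move: uv => /eqP ->; exists [::] => /=.
case: lp uv => <- lp /andP[/eqP <- pv].
rewrite /inv_word /= rev_cons -cats1; apply: (@labelled_walk_cat (tgt e)).
  by apply: IHw; exists p.
by rewrite -lab_bar -src_bar -[src e]tgt_bar; apply: labelled_walk_edge.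
Qed.

Definition immersion := forall e e' : edge D,
  src e = src e' -> lab e = lab e' -> e = e'.

Hypothesis immD : immersion.

Lemma labelled_walk_inj u w v v' :
  labelled_walk u w v -> labelled_walk u w v' -> v = v'.
Proof.
move=> [p pv <-] [q]; elim: p u pv q => [|e p IHp] u /=.
  by move=> /eqP -> [|? ?] //= /eqP.
move=> /andP[/eqP su pv] [|e' q] //= /andP[/eqP su' qv] [le lq].
by apply: (IHp _ pv q) lq; rewrite -(immD (etrans su' (esym su)) le).
Qed.

Lemma immersion_walk_push u v a w :
  labelled_walk u (a :: w) v -> labelled_walk u (push a w) v.
Proof.
move=> [[//|e p] /= /andP[/eqP su pv] [la lw]].
case: w lw => [|b w] lw /=; first by exists (e :: p); rewrite /= ?su ?eqxx ?la ?lw.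
case: eqP => [eb|_]; last by exists (e :: p); rewrite /= ?su ?eqxx ?la ?lw.
case: p lw pv => //= e' p [le' lw] /andP[/eqP se' pv]; exists p => //.
suff ee' : e' = bar e by rewrite -su -[src e]tgt_bar -ee'.
by apply: immD; rewrite ?se' ?src_bar // le' eb lab_bar la.
Qed.

Lemma immersion_walk_word_elt u v w :
  labelled_walk u w v -> labelled_walk u (word_elt w) v.
Proof.
elim: w u => // a w IHw u [[//|e p] /= /andP[su pv] [le lw]].
apply: immersion_walk_push.
have [|q qv lq] := IHw (tgt e); first by exists p.
by exists (e :: q); rewrite /= ?su ?le ?lq.
Qed.

Lemma immersion_walk_mul (x y : free_group X) u v t :
  labelled_walk u x v -> labelled_walk v y t ->
  labelled_walk u (x * y : free_group X) t.
Proof.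
move=> uxv vyt; rewrite -[x]word_eltK -[y]word_eltK -word_elt_cat.
exact: immersion_walk_word_elt (labelled_walk_cat uxv vyt).
Qed.

Lemma immersion_walk_subgroup u :
  is_subgroup [set x : free_group X | labelled_walk u x u]%classic.
Proof.
split=> [|x y uxu uyu]; first by exists [::] => /=.
exact: (@immersion_walk_mul x y^-1) uxu (labelled_walk_inv uyu).
Qed.

End Walks.

Section StallingsInvariant.
Variables (X : finType) (H : set (free_group X)).
Hypothesis subgroupH : is_subgroup H.

(* The assignment [v |-> H g(v)] is a morphism of based graphs from [D] to the
   Schreier graph of [H]. *)
Definition schreier_labelling (D : based_graph X)
    (g : vertex D -> free_group X) :=
  H (g (base D)) /\
  forall e, same_rcoset H (g (src e) * letter_elt (lab e)) (g (tgt e)).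

Definition accessible (D : based_graph X) :=
  forall v : vertex D, exists w, labelled_walk (base D) w v.

Lemma schreier_labelling_walk (D : based_graph X) (g : vertex D -> free_group X) :
  schreier_labelling g -> forall u w v, labelled_walk u w v ->
  same_rcoset H (g u * word_elt w) (g v).
Proof.
move=> [_ gE] u w v [p pv <-]; elim: p u pv => [|e p IHp] u /=.
  by move=> /eqP ->; rewrite word_elt_nil mulg1; apply: same_rcoset_refl.
move=> /andP[/eqP <- /IHp]; rewrite word_elt_cons mulgA.
by apply: same_rcoset_trans => //; apply: same_rcosetMr.
Qed.

Section FoldMorphism.
Variables (D : based_graph X) (e1 e2 : edge D).
Hypothesis adm : admissible e1 e2.

Lemma fold_point_tgt : fold_point e1 e2 (tgt e1) = fold_point e1 e2 (tgt e2).
Proof. by apply: val_inj; rewrite /= /fold_repr eqxx; case: ifP. Qed.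

Lemma fold_edge_lift (e : edge D) : exists e' : edge (fold e1 e2),
  [/\ src e' = fold_point e1 e2 (src e), tgt e' = fold_point e1 e2 (tgt e)
    & lab e' = lab e].
Proof.
have /and4P[ne nb /eqP se /eqP le] := adm.
have e1P : (e1 != e2) && (e1 != bar e2).
  by rewrite ne; apply: contra nb => /eqP ->; rewrite barK.
have [->|ne2] := eqVneq e e2.
  exists (Sub e1 e1P); split=> //; last exact: fold_point_tgt.
  by rewrite -se.
have [->|nb2] := eqVneq e (bar e2).
  exists (fold_bar (Sub e1 e1P)); split.
  - by rewrite [LHS]/= fold_src_bar src_bar; exact: fold_point_tgt.
  - by rewrite [LHS]/= fold_tgt_bar tgt_bar -se.
  - by rewrite [LHS]/= fold_lab_bar lab_bar -le.
have eP : (e != e2) && (e != bar e2) by rewrite ne2.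
by exists (Sub e eP).
Qed.

Lemma fold_walk u w v : labelled_walk u w v ->
  @labelled_walk X (fold e1 e2) (fold_point e1 e2 u) w (fold_point e1 e2 v).
Proof.
move=> [p pv <-]; elim: p u pv => [|e p IHp] u /=.
  by move=> /eqP ->; exists [::] => /=.
move=> /andP[/eqP <- /IHp walk_v]; have [e' [se te le]] := fold_edge_lift e.
rewrite -cat1s; apply: labelled_walk_cat walk_v.
by rewrite -se -te -le; apply: labelled_walk_edge.
Qed.

Lemma fold_accessible : accessible D -> accessible (fold e1 e2).
Proof.
move=> accD [v vP]; have [w /fold_walk walk_v] := accD v.
suff vE : fold_point e1 e2 v = exist _ v vP by exists w; rewrite -vE.
apply: val_inj; rewrite /= /fold_repr.
by case: (v =P tgt e2) vP => // ->; rewrite orbF => /eqP.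
Qed.

Lemma fold_schreier_labelling (g : vertex D -> free_group X) :
  schreier_labelling g ->
  schreier_labelling (fun v : vertex (fold e1 e2) => g (val v)).
Proof.
move=> [gbase gE]; have /and4P[_ _ /eqP se /eqP le] := adm.
have g12 : same_rcoset H (g (tgt e1)) (g (tgt e2)).
  apply: same_rcoset_trans (same_rcoset_sym subgroupH (gE e1)) _ => //.
  by rewrite se le; apply: gE.
have gr v : same_rcoset H (g (fold_repr e1 e2 v)) (g v).
  by rewrite /fold_repr; case: eqP => [->|_] //; apply: same_rcoset_refl.
split=> [|e] /=.
  exact: same_rcoset_mem (gr _) gbase.
apply: same_rcoset_trans (same_rcosetMr _ (gr _)) _ => //.
apply: same_rcoset_trans (gE _) _ => //.
by apply: same_rcoset_sym.
Qed.

End FoldMorphism.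

Section WedgeMorphism.
Variables (m : nat) (w : 'I_m -> free_group X).
Hypothesis Hw : forall i, H (w i).

Definition wedge_labelling (v : wedge_vertex w) : free_group X :=
  if v is Some t then word_elt (take (tagged t).+1 (w (tag t))) else 1.

Lemma wedge_point_size i : wedge_point w i (size (w i)) = None.
Proof.
case E: (size (w i)) => [|k] //=; rewrite insubF //.
by rewrite E ltnn.
Qed.

Lemma wedge_labelling_point i k : (k <= size (w i))%N ->
  same_rcoset H (wedge_labelling (wedge_point w i k)) (word_elt (take k (w i))).
Proof.
rewrite leq_eqVlt => /predU1P[->|ltk].
  rewrite wedge_point_size take_size word_eltK /same_rcoset mul1g.
  exact: is_subgroupV.
case: k ltk => [|k] ltk /=.
  by rewrite take0 word_elt_nil; apply: same_rcoset_refl.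
case: insubP => [j _ <-|] /=; first exact: same_rcoset_refl.
by rewrite -ltnS prednK ?ltk // (leq_trans _ ltk).
Qed.

Lemma wedge_schreier_labelling :
  @schreier_labelling (wedge w) wedge_labelling.
Proof.
split; first by case: subgroupH.
suff pos e : same_rcoset H
    (wedge_labelling (@wedge_src _ _ w (e, false)) *
      letter_elt (wedge_lab (e, false)))
    (wedge_labelling (wedge_tgt (e, false))).
  case=> e [] //=.
  rewrite -[wedge_lab _]inv_letterK letter_eltV -wedge_lab_bar /wedge_bar /=.
  have /(same_rcosetMr (letter_elt (wedge_lab (e, false)))^-1) := pos e.
  by rewrite mulgK => /(same_rcoset_sym subgroupH).
case: e => i k; rewrite /wedge_src /wedge_tgt /wedge_end /wedge_lab /=.
have ltk := ltn_ord k.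
apply: same_rcoset_trans (same_rcosetMr _ (wedge_labelling_point (ltnW ltk))) _ => //.
apply: same_rcoset_sym => //.
apply: same_rcoset_trans (wedge_labelling_point ltk) _ => //.
have a0 := tnth (in_tuple (w i)) k.
rewrite (take_nth a0) // -cats1 word_elt_cat word_elt_cons word_elt_nil mulg1.
by rewrite (tnth_nth a0); apply: same_rcoset_refl.
Qed.

Lemma wedge_walk_point i k : (k <= size (w i))%N ->
  @labelled_walk X (wedge w) None (take k (w i)) (wedge_point w i k).
Proof.
elim: k => [|k IHk] ltk; first by rewrite take0; exists [::] => /=.
pose a0 := tnth (in_tuple (w i)) (Ordinal ltk).
rewrite (take_nth a0) // -cats1; apply: labelled_walk_cat (IHk (ltnW ltk)) _.
have := @labelled_walk_edge X (wedge w)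
  (existT (fun i => 'I_(size (w i))) i (Ordinal ltk), false).
by rewrite /= /wedge_lab /= (tnth_nth a0).
Qed.

Lemma wedge_walk i : @labelled_walk X (wedge w) None (w i) None.
Proof. by have := @wedge_walk_point i _ (leqnn _); rewrite take_size wedge_point_size. Qed.

Lemma wedge_accessible : accessible (wedge w).
Proof.
case=> [[i j]|]; last by exists [::]; exists [::] => /=.
have ltj : (j.+1 <= size (w i))%N by rewrite (leq_trans (ltn_ord j)) ?leq_pred.
exists (take j.+1 (w i)); have := wedge_walk_point ltj.
by rewrite /= valK.
Qed.

End WedgeMorphism.

Lemma folds_to_immersion (D S : based_graph X) : folds_to D S -> immersion S.
Proof.
elim=> // {D S} D nadm e e' se le; apply/eqP/negP => /negP ne.
have /and4P[] := nadm e e'; split; rewrite ?se ?le //; apply/eqP => eb.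
by move/(congr1 snd): le; rewrite eb lab_bar /=; case: (lab e).2.
Qed.

Lemma folds_to_walk (D S : based_graph X) w : folds_to D S ->
  labelled_walk (base D) w (base D) -> labelled_walk (base S) w (base S).
Proof. by elim=> // D' e1 e2 S' adm _ IH /(fold_walk adm)/IH. Qed.

Lemma folds_to_accessible (D S : based_graph X) :
  folds_to D S -> accessible D -> accessible S.
Proof. by elim=> // D' e1 e2 S' adm _ IH /(fold_accessible adm)/IH. Qed.

Lemma folds_to_schreier_labelling (D S : based_graph X) : folds_to D S ->
  (exists g : vertex D -> _, schreier_labelling g) ->
  exists g : vertex S -> _, schreier_labelling g.
Proof.
elim=> // D' e1 e2 S' adm _ IH [g /(fold_schreier_labelling adm) gP].
by apply: IH; eexists; apply: gP.
Qed.

Lemma schreier_labelling_inj (S : based_graph X) (g : vertex S -> free_group X) :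
  immersion S -> accessible S ->
  (forall x, H x -> labelled_walk (base S) x (base S)) ->
  schreier_labelling g ->
  forall u v, same_rcoset H (g u) (g v) -> u = v.
Proof.
move=> immS accS walkH gP u v guv.
have gcoset t w : labelled_walk (base S) w t -> same_rcoset H (word_elt w) (g t).
  move=> /(schreier_labelling_walk gP); apply: same_rcoset_trans => //.
  by rewrite /same_rcoset invMg mulgA mulgV mul1g; apply: is_subgroupV; case: gP.
have [p pu] := accS u; have [q qv] := accS v.
have pq : H (word_elt p * (word_elt q)^-1).
  apply: same_rcoset_trans (gcoset _ _ pu) _ => //.
  apply: same_rcoset_trans guv _ => //.
  by apply: same_rcoset_sym => //; apply: gcoset.
have := immersion_walk_mul immS (walkH _ pq) (immersion_walk_word_elt immS qv).
rewrite mulgVK; apply: labelled_walk_inj => //.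
exact: immersion_walk_word_elt.
Qed.

End StallingsInvariant.

Lemma stallings_graph_schreier (X : finType) (H : set (free_group X))
    (S : based_graph X) : is_subgroup H -> stallings_graph H S ->
  immersion S /\ exists2 g : vertex S -> free_group X,
    schreier_labelling H g &
    forall u v, same_rcoset H (g u) (g v) -> u = v.
Proof.
move=> sH [m [w [HE foldS]]]; have immS := folds_to_immersion foldS.
split=> //.
have Hw i : H (w i) by rewrite HE => A [_]; apply; exists i.
have [g gP] := folds_to_schreier_labelling sH foldS
  (ex_intro _ _ (wedge_schreier_labelling sH Hw)).
exists g => //; apply: schreier_labelling_inj gP => //.
  exact: folds_to_accessible foldS (@wedge_accessible _ _ w).
move=> x; rewrite HE.
move=> /(_ [set x : free_group X | labelled_walk (base S) x (base S)]%classic).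
apply; split; first exact: immersion_walk_subgroup.
by move=> _ [i _ <-]; apply: folds_to_walk foldS _; apply: wedge_walk.
Qed.

Section ActionGraph.
Variables (X : finType) (gT : finGroupType) (T : finType).
Variables (to : {action gT &-> T}) (f : free_group X -> gT).
Hypothesis fM : {morph f : x y / x * y}.

Let f1 : f 1 = 1. Proof. exact: morph_one. Qed.
Let fV x : f x^-1 = (f x)^-1.
Proof. by apply: (mulgI (f x)); rewrite -fM !mulgV. Qed.

Definition action_edge : finType := (T * letter X)%type.
Definition action_tgt (e : action_edge) : T := to e.1 (f (letter_elt e.2)).
Definition action_bar (e : action_edge) : action_edge :=
  (action_tgt e, inv_letter e.2).

Lemma action_bar_neq e : action_bar e != e.
Proof.
by apply/eqP => /(congr1 (fun e => e.2.2)) /=; case: e.2.2.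
Qed.

Lemma action_tgt_bar e : action_tgt (action_bar e) = e.1.
Proof. by rewrite /action_tgt /= letter_eltV fV actK. Qed.

Lemma action_barK : involutive action_bar.
Proof. by case=> t a; rewrite {1}/action_bar action_tgt_bar /= inv_letterK. Qed.

Definition action_graph : lgraph X :=
  @LGraph X T action_edge fst action_tgt action_bar snd
    action_bar_neq action_barK (fun=> erefl) action_tgt_bar (fun=> erefl).

Lemma action_graph_covering : covering action_graph.
Proof. by move=> v a; exists (v, a); split=> // -[? ?] /= [-> ->]. Qed.

Lemma action_walkP (u : T) w v :
  @labelled_walk X action_graph u w v <-> v = to u (f (word_elt w)).
Proof.
elim: w u => [|a w IHw] u.
  rewrite word_elt_nil f1 act1; split=> [[[|e p] //= /eqP ->]|->] //.
  by exists [::] => /=.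
rewrite word_elt_cons fM actM; split.
  move=> [[//|[u' b] p] /= /andP[/eqP <- pv] [<- lp]].
  by apply/IHw; exists p.
move=> /IHw[p pv lp]; exists ((u, a) :: p); last by rewrite /= lp.
by rewrite /= eqxx.
Qed.

Hypothesis f_surj : forall y, exists x, f x = y.

Lemma action_graph_connected :
  [transitive [set: gT], on [set: T] | to] -> connected action_graph.
Proof.
move=> trT u v; have := atransP2 trT (finset.in_setT u) (finset.in_setT v).
move=> [y _ ->]; have [x <-] := f_surj y.
have /action_walkP[p pv _] : to u (f x) = to u (f (word_elt x)).
  by rewrite word_eltK.
by exists p.
Qed.

Lemma action_graph_deck :
  deck_group action_graph_covering = (actperm to @* [set: gT])%G.
Proof.
apply/val_inj/setP => p /=; rewrite inE; apply/asboolP/morphimP.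
  move=> [w wp]; exists (f w); rewrite ?inE //.
  by apply/permP => u; rewrite actpermE -{1}[w]word_eltK; apply/action_walkP.
move=> [y _ _ ->]; have [x <-] := f_surj y.
by exists x => u; apply/action_walkP; rewrite actpermE word_eltK.
Qed.

Lemma action_graph_deck_in (V : pseudovariety) :
  V gT [set: gT]%G -> V _ (deck_group action_graph_covering).
Proof.
move=> Vg; rewrite action_graph_deck.
exact: pv_isog (first_isog _) (pv_quo (ker_normal _) Vg).
Qed.

End ActionGraph.

Section RightCosetAction.
Variables (gT : finGroupType) (K : {group gT}).

Lemma mem_rcosetsT x : K :* x \in rcosets K [set: gT].
Proof. by apply/rcosetsP; exists x; rewrite ?finset.in_setT. Qed.

Definition rcoset_space : finType :=
  {A : {set gT} | A \in rcosets K [set: gT]}.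

Lemma rcoset_act_subproof (A : rcoset_space) x :
  val A :* x \in rcosets K [set: gT].
Proof.
case: A => A /= /rcosetsP[y _ ->].
by rewrite -rcosetM mem_rcosetsT.
Qed.

Definition rcoset_act (A : rcoset_space) x : rcoset_space :=
  Sub (val A :* x) (rcoset_act_subproof A x).

Lemma rcoset_act1 A : rcoset_act A 1 = A.
Proof. by apply: val_inj; rewrite /= rcoset1. Qed.

Lemma rcoset_actM A : act_morph rcoset_act A.
Proof. by move=> x y; apply: val_inj; rewrite /= rcosetM. Qed.

Definition rcoset_action := TotalAction rcoset_act1 rcoset_actM.

Definition rcoset_pt x : rcoset_space :=
  Sub (K :* x) (mem_rcosetsT x).

Lemma rcoset_action_pt x y : rcoset_action (rcoset_pt x) y = rcoset_pt (x * y).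
Proof. by apply: val_inj; rewrite /= rcosetM. Qed.

Lemma rcoset_pt_surj A : exists x, A = rcoset_pt x.
Proof.
case: A => A KA; have /rcosetsP[x _ eA] := KA.
by exists x; apply: val_inj.
Qed.

Lemma rcoset_pt_eq x y : (rcoset_pt x == rcoset_pt y) = (x * y^-1 \in K).
Proof. by rewrite -val_eqE /= -mem_rcoset; apply/eqP/rcoset_eqP. Qed.

Lemma rcoset_action_trans : [transitive [set: gT], on [set: rcoset_space] | rcoset_action].
Proof.
apply/imsetP; exists (rcoset_pt 1); rewrite ?inE //.
apply/setP => A; rewrite inE; apply/esym/imsetP.
have [x ->] := rcoset_pt_surj A.
by exists x; rewrite ?inE ?rcoset_action_pt ?mul1g.
Qed.

End RightCosetAction.

Lemma quotient_in_full (V : pseudovariety) (G : groupType) (N : set G) :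
  quotient_in V N ->
  exists (gT : finGroupType) (f : G -> gT),
    [/\ {morph f : x y / x * y}, forall y, exists x, f x = y,
        forall x, f x = 1 -> N x & V gT [set: gT]%G].
Proof.
move=> [gT [Q [f [fM fQ -> VQ]]]].
have fin x : f x \in Q by have : range f (f x) by []; rewrite fQ.
exists (subg_of Q), (fun x => subg Q (f x)); split=> [x y|y|x /= fx1|].
- by rewrite fM subgM.
- have : range f (sgval y) by rewrite fQ /=; apply: subgP.
  by move=> [x _ fx]; exists x; rewrite fx sgvalK.
- by rewrite -[f x](@subgK _ Q) // fx1.
- exact: pv_isog (isog_subg Q) VQ.
Qed.

Lemma pro_closed_separate (V : pseudovariety) (G : groupType) (H : set G)
    (I : finType) (x : I -> G) :
  pro_closed V H -> (forall i, ~ H (x i)) ->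
  exists (gT : finGroupType) (f : G -> gT),
    [/\ {morph f : x y / x * y}, forall y, exists x, f x = y,
        forall i h, H h -> f (x i) <> f h & V gT [set: gT]%G].
Proof.
move=> clH nHx.
have sepN i : exists N : set G,
    quotient_in V N /\ forall n, N n -> ~ H (x i * n).
  apply: contrapT => nN; apply: (nHx i); apply: clH => B [N [_ qN NB]].
  apply: contrapT => nHB; apply: nN; exists N; split=> // n Nn Hxn.
  by apply: nHB; exists (x i * n); split=> //; apply: NB.
have [N NP] := choice sepN.
have [|gT [f [fM fs fN Vg]]] := @quotient_in_full V G
    [set y | forall i, N i y]%classic.
  by apply: quotient_in_forall => i; case: (NP i).
exists gT, f; split=> // i h Hh fxh.
have /fN/(_ i) Nxh : f ((x i)^-1 * h) = 1.
  by rewrite fM -fxh -fM mulVg morph_one.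
by have [_ /(_ _ Nxh)] := NP i; rewrite mulKVg.
Qed.

Lemma subgroup_image_group_set (G : groupType) (gT : finGroupType)
    (f : G -> gT) (H : set G) :
  {morph f : x y / x * y} -> is_subgroup H ->
  group_set [set y | `[< exists2 x, H x & f x = y >]].
Proof.
move=> fM sH; have [H1 HB] := sH; apply/group_setP; split=> [|a b].
  by rewrite !inE; exists 1 => //; apply: morph_one.
rewrite !inE => -[x Hx <-] [y Hy <-].
exists (x * y); last exact: fM.
by rewrite -[y]invgK; apply: HB => //; apply: is_subgroupV.
Qed.

Theorem lemma1p11 (V : pseudovariety)
    (extV : closed_under_abelian_kernel_extensions V)
    (X : finType) (H : set (free_group X))
    (subgroupH : is_subgroup H) (fgH : finitely_generated H)
    (closedH : pro_closed V H) :
  forall S : based_graph X, stallings_graph H S ->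
  exists (D : lgraph X) (covD : covering D),
    [/\ connected D, labelled_subgraph S D & V _ (deck_group covD)].
Proof.
move=> S /(stallings_graph_schreier subgroupH)[immS [g [_ gE] g_inj]].
pose I : finType := {uv : vertex S * vertex S | uv.1 != uv.2}.
have nH (i : I) : ~ H (g (val i).1 * (g (val i).2)^-1).
  by case: i => -[u v] /= /eqP nuv /g_inj.
have [gT [f [fM fs fH Vg]]] := pro_closed_separate closedH nH.
pose K := Group (subgroup_image_group_set fM subgroupH).
have fB x y : f (x * y^-1) = f x * (f y)^-1.
  by apply: (mulIg (f y)); rewrite -fM !mulgVK.
pose to := rcoset_action K.
exists (action_graph to fM), (@action_graph_covering _ _ _ to f fM); split.
- exact: action_graph_connected (rcoset_action_trans K).
- pose fv v := rcoset_pt K (f (g v)).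
  have fv_inj : injective fv.
    move=> u v /eqP; rewrite rcoset_pt_eq !inE => -[h Hh fh].
    apply/eqP; apply: contrapT => /negP nuv.
    by apply: (fH (exist _ (u, v) nuv) h Hh); rewrite fh fB.
  have fv_tgt e : action_tgt to f (fv (src e), lab e) = fv (tgt e).
    apply: etrans (rcoset_action_pt _ _ _) _; rewrite -fM; apply/eqP.
    rewrite rcoset_pt_eq -fB !inE.
    by exists (g (src e) * letter_elt (lab e) * (g (tgt e))^-1) => //; apply: gE.
  exists fv, (fun e => (fv (src e), lab e)); split=> //.
  + move=> e e' ee'; apply: immS.
      exact/fv_inj/(congr1 (@fst (rcoset_space K) (letter X)) ee').
    exact: (congr1 (@snd (rcoset_space K) (letter X)) ee').
  + by move=> e; split; last exact: fv_tgt.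
  + by move=> e; rewrite /= /action_bar fv_tgt src_bar lab_bar.
- exact: action_graph_deck_in.
Qed.
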